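(* Let $n\geq 2$ be an integer. The Segre-Veronese variety $SV^{(1,1,n)}_{(1,a(n+3)-2,1)}$ is $(2a(n+1)-1)$-defective for all integers $a\geq 1$. Moreover, if $n$ is odd then the Segre-Veronese variety $SV^{(1,1,n)}_{(1,a(n+3)/2-2,1)}$ is $(a(n+1)-1)$-defective for all integers $a\geq 1$. In particular $SV^{(1,1,3)}_{(1,7,1)}$ is $11$-defective.
   Context: All varieties are over $\mathbb{C}$. $SV^{(n_1,\dots,n_r)}_{(d_1,\dots,d_r)}\subseteq\mathbb{P}^N$, with $N=\prod_{i=1}^r\binom{n_i+d_i}{d_i}-1$, is the image of $\mathbb{P}^{n_1}\times\dots\times\mathbb{P}^{n_r}$ under the embedding induced by the complete linear system $|\mathcal{O}_{\mathbb{P}^{n_1}\times\dots\times\mathbb{P}^{n_r}}(d_1,\dots,d_r)|$. For an irreducible non-degenerate $n$-dimensional variety $X\subseteq\mathbb{P}^N$ and $h\geq 1$, the $h$-secant variety $\mathrm{Sec}_h(X)$ is the Zariski closure of the union of all linear spaces spanned by collections of $h$ points of $X$; its expected dimension is $\min\{nh+h-1,N\}$. $X$ is $h$-defective if $\dim \mathrm{Sec}_h(X)$ is strictly smaller than the expected dimension. *)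

(* Defs.v *)
From mathcomp Require Import all_boot all_order all_algebra.
From mathcomp Require Import classical_sets reals complex mpoly.

Set Implicit Arguments.
Unset Strict Implicit.
Unset Printing Implicit Defensive.

Import GRing.Theory.

Local Open Scope classical_set_scope.
Local Open Scope ring_scope.

Section Projective.
Variable K : fieldType.
Implicit Type N : nat.

(* Points of P^N are the lines through the origin of K^(N+1). *)
Definition proj N := {U : {vspace 'rV[K]_N.+1} | \dim U == 1%N}.

Definition vanishes N (f : {mpoly K[N.+1]}) (p : proj N) :=
  forall v, v \in val p -> f.@[fun i => v ord0 i] = 0.

Definition homogeneous N (f : {mpoly K[N.+1]}) := exists d, f \is d.-homog.

Definition zero_locus N (S : set {mpoly K[N.+1]}) : set (proj N) :=
  [set p | forall f, S f -> vanishes f p].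

Definition zclosed N (Z : set (proj N)) :=
  exists2 S : set {mpoly K[N.+1]}, S `<=` @homogeneous N & Z = zero_locus S.

Definition zclosure N (A : set (proj N)) : set (proj N) :=
  [set p | forall Z, zclosed Z -> A `<=` Z -> Z p].

(* Z is irreducible as a subspace: its closed subsets are traces of closed
   subsets of P^N. *)
Definition irreducible N (Z : set (proj N)) :=
  Z !=set0 /\
  forall A B, zclosed A -> zclosed B ->
    Z `<=` A `|` B -> Z `<=` A \/ Z `<=` B.

Definition irreducible_chain N (Y : set (proj N)) (k : nat)
    (Z : nat -> set (proj N)) :=
  (forall i, (i <= k)%N ->
     irreducible (Z i) /\ exists2 A, zclosed A & Z i = Y `&` A) /\
  (forall i, (i < k)%N -> Z i `<` Z i.+1).

(* Krull dimension of Y for the induced Zariski topology. *)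
Definition has_dim N (Y : set (proj N)) (k : nat) :=
  (exists Z, irreducible_chain Y k Z) /\
  (forall l Z, irreducible_chain Y l Z -> (l <= k)%N).

(* The h points need not be distinct; a span of fewer than h points lies in
   the span of h points. *)
Definition secant_variety N (h : nat) (X : set (proj N)) : set (proj N) :=
  zclosure [set p | exists2 q : 'I_h -> proj N,
    forall i, X (q i) & (val p <= \sum_(i < h) val (q i))%VS].

Definition expected_secant_dim (N n h : nat) : nat :=
  minn (n * h + h - 1) N.

Definition defective N (h : nat) (X : set (proj N)) :=
  exists n s, [/\ has_dim X n, has_dim (secant_variety h X) s &
    (s < expected_secant_dim N n h)%N].

End Projective.

(* The bound on the degree only serves to get a finite type. *)
Definition monom (m d : nat) := {u : 'X_{1..m < d.+1} | mdeg u == d}.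

Lemma card_monom n d : #|{: monom n.+1 d}| = 'C(n + d, d).
Proof.
rewrite addnC -(size_basis n d).
pose bm (u : monom n.+1 d) : 'X_{1..n.+1} := bmnm (val u).
have bm_inj : injective bm by move=> u v /val_inj /val_inj.
rewrite cardE -(size_map bm); apply/esym/perm_size.
apply: uniq_perm; rewrite ?uniq_basis //.
  by rewrite map_inj_uniq // enum_uniq.
move=> m; rewrite -basis_cover; apply/idP/mapP => [dm|[u _ ->]]; last first.
  exact: (valP u).
have lt_m : (mdeg m < d.+1)%N by rewrite (eqP dm).
by exists (exist _ (BMultinom lt_m) dm); rewrite ?mem_enum.
Qed.

Section SegreVeronese.
Variable r : nat.
Implicit Types n d : r.-tuple nat.

(* Monomials of multidegree (d_1, ..., d_r): the standard basis of the global
   sections of O(d_1, ..., d_r) on P^(n_1) x ... x P^(n_r). *)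
Definition mmonom n d :=
  {dffun forall i : 'I_r, monom (tnth n i).+1 (tnth d i)}.

Definition sv_ambient n d : nat :=
  (\prod_(i < r) 'C(tnth n i + tnth d i, tnth d i)).-1.

Lemma card_mmonom n d : (sv_ambient n d).+1 = #|{: mmonom n d}|.
Proof.
rewrite card_dep_ffun foldrE big_map big_enum /= prednK; last first.
  by rewrite prodn_gt0 // => i; rewrite bin_gt0 leq_addl.
by apply: eq_bigr => i _; rewrite card_monom.
Qed.

Definition mmonom_of n d (j : 'I_(sv_ambient n d).+1) : mmonom n d :=
  enum_val (cast_ord (card_mmonom n d) j).

Variable K : fieldType.

Definition sv_map n d (x : forall i : 'I_r, 'rV[K]_(tnth n i).+1) :
    'rV[K]_(sv_ambient n d).+1 :=
  \row_j \prod_(i < r) \prod_(k < (tnth n i).+1)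
    x i ord0 k ^+ bmnm (val (mmonom_of j i)) k.

Definition segre_veronese n d : set (proj K (sv_ambient n d)) :=
  [set p | exists2 x : forall i : 'I_r, 'rV[K]_(tnth n i).+1,
    forall i, x i != 0 & val p = <[sv_map d x]>%VS].

End SegreVeronese.
Arguments segre_veronese {r} K n d.

(* Main.v *)
Require Import Defs.
From mathcomp Require Import all_boot all_order all_algebra.
From mathcomp Require Import boolp classical_sets reals complex mpoly.
From mathcomp Require Import zify.

(** Let [p] and [q] be positive with [2 * p = n.+1 * q], and let [X] be the
    Segre-Veronese variety of P^1 x P^1 x P^n in degrees (1, p + q - 2, 1). A
    vector of the ambient space is a tensor in C^2 (x) S^(p+q-2) C^2 (x) C^(n+1).
    The inclusion of S^(p+q-2) in S^(p-1) (x) S^(q-1) turns it into a linear map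
    between C^2 (x) S^(p-1) C^2 and S^(q-1) C^2 (x) C^(n+1), that is, into a
    square matrix of size [2 * p], the catalecticant, made of Hankel blocks. At a
    point of [X] this matrix has rank one ([rank_catalecticant_sv]), so on the
    span of [2 * p - 1] points its determinant vanishes ([span_cat_form]). The
    determinant is not identically zero: some tensor has the identity as its
    catalecticant ([catalecticant_witness]). Hence the secant variety lies in a
    hypersurface, whereas for [1 < n] the count of parameters predicts that it
    fills the space. The theorem is the case [p = a * (n + 1)], [q = 2 * a], and,
    for odd [n], the case [p = a * (n + 1) / 2], [q = a].

    Dimension being Krull dimension, three facts about chains of irreducible sets
    support this. A chain in P^N has length at most [N] ([form_chain_leq]): a form
    vanishing on one term and not on the next is a nonzerodivisor modulo the prime
    ideal of the latter, so that each step of the chain raises by one the degree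
    of growth of the Hilbert function, which is at most [N]. A chain inside a
    hypersurface can be prolonged by the whole space, so it is shorter than [N]
    ([irreducible_chain_ltn]). Finally the images of products of coordinate
    subspaces form a chain in a Segre-Veronese variety whose length is the
    dimension of the product ([segre_veronese_dim_geq]); this bounds the expected
    dimension from below. Irreducibility is obtained each time by joining two
    points by a rational curve ([irreducible_of_curves]). *)

Set Implicit Arguments.
Unset Strict Implicit.
Unset Printing Implicit Defensive.

(** * Forms and irreducible sets *)

Section Vanishing.
Import GRing.Theory.
Local Open Scope classical_set_scope.
Local Open Scope ring_scope.

Variables (K : fieldType) (N : nat).
Implicit Types (f g : {mpoly K[N.+1]}) (Z Y : set (proj K N)) (p q : proj K N).
Implicit Type v : 'rV[K]_N.+1.

Definition form_at v f : K := f.@[fun i => v ord0 i].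

Lemma form_atZ d f c v :
  f \is d.-homog -> form_at (c *: v) f = c ^+ d * form_at v f.
Proof.
move=> fd; rewrite /form_at !mevalE mulr_sumr !big_seq.
apply: eq_bigr => m mf; rewrite mulrCA; congr (_ * _).
rewrite -(dhomog_mf fd mf) /= mdegE -prodrXr -big_split /=.
by apply: eq_bigr => i _; rewrite mxE exprMn.
Qed.

Lemma form_at_dhomog0 d f : (0 < d)%N -> f \is d.-homog -> form_at 0 f = 0.
Proof.
by move=> d0 fd; rewrite -(scale0r 0) (form_atZ _ _ fd) expr0n gtn_eqF // mul0r.
Qed.

Lemma form_at_coord v i : form_at v 'X_i = v ord0 i.
Proof. exact: mevalXU. Qed.

Definition generator p : 'rV[K]_N.+1 := vpick (val p).

Lemma mem_generator p : generator p \in val p. Proof. exact: memv_pick. Qed.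

Lemma generator_neq0 p : generator p != 0.
Proof. by rewrite vpick0 -dimv_eq0 (eqP (valP p)). Qed.

Lemma proj_lineP p v : v \in val p -> v != 0 -> val p = <[v]>%VS.
Proof.
move=> vp v0; apply/esym/eqP; rewrite eqEdim -memvE vp /=.
by rewrite (eqP (valP p)) dim_vline v0.
Qed.

Lemma proj_point_subproof v : v != 0 -> \dim <[v]>%VS == 1%N.
Proof. by rewrite dim_vline => ->. Qed.

Definition proj_point v (v0 : v != 0) : proj K N :=
  exist _ <[v]>%VS (proj_point_subproof v0).

(** By homogeneity, one nonzero vector of the line decides for the whole line. *)
Lemma vanishesE f p v : homogeneous f -> v \in val p -> v != 0 ->
  vanishes f p <-> form_at v f = 0.
Proof.
move=> [d fd] vp v0; split=> [|f0 w]; first exact.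
rewrite (proj_lineP vp v0) => /vlineP[c ->].
by rewrite -/(form_at _ _) (form_atZ _ _ fd) f0 mulr0.
Qed.

Lemma vanishes_generator f p : homogeneous f ->
  vanishes f p <-> form_at (generator p) f = 0.
Proof.
by move=> fh; apply: vanishesE; [|exact: mem_generator|exact: generator_neq0].
Qed.

Lemma proj_eq p q v : v != 0 -> v \in val p -> v \in val q -> p = q.
Proof.
by move=> v0 vp vq; apply/val_inj; rewrite (proj_lineP vp v0) (proj_lineP vq v0).
Qed.

Definition vanish_on f Z := forall p, Z p -> vanishes f p.

Lemma vanish_onW f Z Y : Z `<=` Y -> vanish_on f Y -> vanish_on f Z.
Proof. by move=> ZY fY p /ZY/fY. Qed.

Lemma vanish_onM f g Z : vanish_on f Z -> vanish_on (f * g) Z.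
Proof. by move=> fZ p Zp v vp; rewrite mevalM (fZ p Zp v vp) mul0r. Qed.

Lemma vanish_on_root f k Z : vanish_on (f ^+ k) Z -> vanish_on f Z.
Proof.
move=> fZ p Zp v vp; have := fZ p Zp v vp; rewrite rmorphXn /=.
by move/eqP; rewrite expf_eq0 => /andP[_ /eqP].
Qed.

Lemma vanish_onX f k Z : (0 < k)%N -> vanish_on f Z -> vanish_on (f ^+ k) Z.
Proof. by case: k => // k _; rewrite exprS; apply: vanish_onM. Qed.

Lemma zclosed1 f : homogeneous f -> zclosed (zero_locus [set f]).
Proof. by move=> fh; exists [set f] => // _ ->. Qed.

(** Each point of [Z] lies on one of the two hypersurfaces, so [Z] lies inside one
    of them: the homogeneous vanishing ideal of [Z] is prime. *)
Lemma irreducible_vanishM f g Z : irreducible Z -> homogeneous f ->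
  homogeneous g -> vanish_on (f * g) Z -> vanish_on f Z \/ vanish_on g Z.
Proof.
move=> [_ Zirr] fh gh fgZ.
have [|ZA|ZB] := Zirr _ _ (zclosed1 fh) (zclosed1 gh).
- move=> p /fgZ /(_ _ (mem_generator p)); rewrite mevalM => /eqP.
  by rewrite mulf_eq0 => /orP[] /eqP f0; [left|right];
    move=> _ ->; apply/vanishes_generator.
- by left=> p /ZA; apply.
- by right=> p /ZB; apply.
Qed.

(** A point of [Z'] outside [Z] lies in [Y], hence violates an equation of [A]. *)
Lemma separating_form Y Z Z' A : zclosed A -> Z = Y `&` A -> Z' `<=` Y ->
  ~ Z' `<=` Z -> exists2 f, homogeneous f & vanish_on f Z /\ ~ vanish_on f Z'.
Proof.
move=> [S Sh ->] ZE Z'Y; apply: contra_notP => H p Z'p; rewrite ZE; split.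
  exact: Z'Y.
move=> f Sf; apply: contrapT => fp; apply: H.
exists f; first exact: Sh.
split=> [q|/(_ p Z'p)//].
by rewrite ZE => -[_ /(_ f Sf)].
Qed.

End Vanishing.

(** * Chains of irreducible sets in projective space have length at most N *)

Section BinomialGrowth.

Lemma leq_expn_ffact m d : d ^ m <= (m + d) ^_ m.
Proof.
elim: m => [|m IH]; first by rewrite ffactn0.
by rewrite addSn ffactSS expnS leq_mul // -addSn leq_addl.
Qed.

Lemma leq_ffact_expn n m : n ^_ m <= n ^ m.
Proof.
elim: m n => [|m IH] n; first by rewrite ffactn0.
rewrite ffactnS expnS leq_mul2l (leq_trans (IH _)) ?orbT //.
by case: m {IH} => // m; rewrite leq_exp2r // leq_pred.
Qed.

(** As [d] grows, the left-hand side is a polynomial of degree [N] in [d] and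
    the right-hand side one of degree [N.+1]. *)
Lemma bin_growth N D :
  exists d, 'C(N + D * d, D * d) < 'C(N.+1 + d, N.+1).
Proof.
(* After multiplication by [N.+1`!] the two sides are compared with
   [((N + D) * d) ^ N * N.+1`!] and [d ^ N.+1], so any [d > b] is large enough. *)
pose b := N.+1`! * (N + D) ^ N; exists b.+1; set d := b.+1.
rewrite -(ltn_pmul2r (fact_gt0 N.+1)) bin_ffact.
apply: leq_trans (leq_expn_ffact N.+1 d).
rewrite -(bin_sub (leq_addl N _)) addnK.
have leC : 'C(N + D * d, N) <= ((N + D) * d) ^ N.
  apply: (@leq_trans ((N + D * d) ^ N)).
    rewrite (leq_trans _ (leq_ffact_expn _ _)) // -bin_ffact.
    by rewrite leq_pmulr // fact_gt0.
  case: (N) => // n; rewrite leq_exp2r // mulnDl leq_add2r leq_pmulr //.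
apply: (@leq_ltn_trans (((N + D) * d) ^ N * N.+1`!)).
  by rewrite leq_mul2r leC orbT.
rewrite expnMn mulnAC (mulnC _ N.+1`!) -/b expnSr mulnC ltn_pmul2l //.
by rewrite expn_gt0.
Qed.

End BinomialGrowth.

Section ChainBound.
Import GRing.Theory.
Local Open Scope classical_set_scope.
Local Open Scope ring_scope.

Variables (K : fieldType) (N : nat).
Implicit Types (f g : {mpoly K[N.+1]}) (Z : nat -> set (proj K N)).
Implicit Types (Y : set (proj K N)) (s : seq {mpoly K[N.+1]}).

(** Linear independence modulo the vanishing ideal of [Y]. *)
Definition independent_on Y s := forall c : nat -> K,
  vanish_on (\sum_(i < size s) c i *: s`_i) Y ->
  forall i, (i < size s)%N -> c i = 0.

Lemma homogeneous_lincomb d s (c : nat -> K) :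
  {in s, forall f, f \is d.-homog} ->
  \sum_(i < size s) c i *: s`_i \is d.-homog.
Proof.
by move=> sd; apply: rpred_sum => i _; apply/rpredZ/sd; rewrite mem_nth.
Qed.

(** The inductive step of the dimension count. Restricting a relation to [Y'],
    where [f] vanishes, kills the coefficients of [s]; what remains is divisible
    by [f], and primality of the ideal of [Y] allows [f] to be cancelled. *)
Lemma independent_on_cat d e f Y Y' s t : irreducible Y -> Y' `<=` Y ->
  f \is e.-homog -> vanish_on f Y' -> ~ vanish_on f Y ->
  {in t, forall g, g \is d.-homog} ->
  independent_on Y' s -> independent_on Y t ->
  independent_on Y (s ++ [seq f * g | g <- t]).
Proof.
move=> Yirr Y'Y fe fY' fY td sI tI c; rewrite size_cat size_map big_split_ord /=.
set G := \sum_(i < size t) c (size s + i)%N *: t`_i.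
have -> : \sum_(i < size t) c (size s + i)%N *:
    (s ++ [seq f * g | g <- t])`_(size s + i) = f * G.
  rewrite mulr_sumr; apply: eq_bigr => i _.
  rewrite nth_cat ltnNge leq_addr /= addKn (nth_map 0) ?ltn_ord //.
  by rewrite scalerAr.
under eq_bigr => i _ do rewrite nth_cat ltn_ord.
move=> sumY.
have cs i : (i < size s)%N -> c i = 0.
  apply: sI => p Y'p v vp; have := sumY _ (Y'Y _ Y'p) v vp.
  by rewrite mevalD mevalM (fY' p Y'p v vp) mul0r addr0.
have ct i : (i < size t)%N -> c (size s + i)%N = 0.
  apply: (tI (fun i => c (size s + i)%N)).
  have : vanish_on (f * G) Y.
    by move: sumY; rewrite big1 ?add0r // => j _; rewrite cs ?scale0r.
  case/(irreducible_vanishM Yirr) => //; first by exists e.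
  by exists d; exact: (homogeneous_lincomb (fun i => c (size s + i)%N)).
move=> i i_lt; case: (ltnP i (size s)) => [/cs//|si].
by rewrite -(subnKC si) ct // ltn_subLR.
Qed.

(** A linear relation among the coefficient vectors would be one among the forms. *)
Lemma size_independent_on d Y s : {in s, forall f, f \is d.-homog} ->
  independent_on Y s -> (size s <= 'C(N + d, d))%N.
Proof.
move=> sd sI; rewrite -card_monom leqNgt; apply/negP => lt_s.
pose A : 'M[K]_(size s, #|{: monom N.+1 d}|) :=
  \matrix_(i, j) (s`_i)@_(bmnm (val (enum_val j))).
have : ~~ row_free A.
  by rewrite -row_leq_rank -ltnNge (leq_ltn_trans (rank_leq_col A)).
rewrite -kermx_eq0 => /rowV0Pn[u /sub_kermxP uA u0].
have [j uj] : exists j, u ord0 j != 0.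
  case/matrix0Pn: u0 => i [j]; rewrite ord1 => uj; by exists j.
pose c k := oapp (fun i : 'I_(size s) => u ord0 i) 0 (insub k).
have cE (i : 'I_(size s)) : c i = u ord0 i by rewrite /c valK.
have : c j = 0.
  apply: sI => // p _ v _; suff -> : \sum_(i < size s) c i *: s`_i = 0.
    exact: meval0.
  apply/mpolyP => m; rewrite mcoeff0.
  have [md|md] := eqVneq (mdeg m) d; last first.
    by apply: dhomog_nemf_coeff (homogeneous_lincomb c sd) md.
  have lt_m : (mdeg m < d.+1)%N by rewrite md.
  pose m' : monom N.+1 d := exist _ (BMultinom lt_m) (introT eqP md).
  have /matrixP/(_ ord0 (enum_rank m')) := uA; rewrite !mxE => <-.
  rewrite raddf_sum; apply: eq_bigr => i _.
  by rewrite mxE enum_rankK /= cE mcoeffZ.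
by rewrite cE => /eqP; rewrite (negPf uj).
Qed.

(** In contrast with [irreducible_chain], no ambient set occurs here, so that a
    chain inside a variety can be prolonged beyond it. *)
Definition form_chain k Z :=
  (forall i, (i <= k)%N -> irreducible (Z i)) /\
  (forall i, (i < k)%N -> Z i `<=` Z i.+1 /\
     exists2 f, homogeneous f & vanish_on f (Z i) /\ ~ vanish_on f (Z i.+1)).

(** Raising the witnesses to suitable powers gives them a common degree, so that
    they can be multiplied without losing homogeneity. *)
Lemma form_chain_common_degree k Z : form_chain k Z ->
  exists D, forall i, (i < k)%N ->
    exists2 f, f \is D.-homog & vanish_on f (Z i) /\ ~ vanish_on f (Z i.+1).
Proof.
move=> [Zirr Zstep].
have /choice[F FP] i : exists fe : {mpoly K[N.+1]} * nat, (i < k)%N ->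
    [/\ fe.1 \is fe.2.-homog, vanish_on fe.1 (Z i) & ~ vanish_on fe.1 (Z i.+1)].
  have [/Zstep[_ [f [e fe] [fZ fZ']]]|] := ltnP i k; last by exists (0, 0%N).
  by exists (f, e).
have e_gt0 i : (i < k)%N -> (0 < (F i).2)%N.
  move=> ik; have [fe fZ fZ'] := FP i ik; rewrite lt0n; apply/eqP => e0.
  have Fh : homogeneous (F i).1 by exists (F i).2.
  have [[p Zp] _] := Zirr i (ltnW ik).
  apply: fZ' => q _; apply/(vanishes_generator _ Fh).
  have /(vanishes_generator _ Fh) f0 := fZ p Zp.
  rewrite e0 in fe; have := form_atZ 0 (generator p) fe.
  by rewrite f0 mulr0 scale0r -(scale0r (generator q)) (form_atZ _ _ fe) mul1r.
exists (\prod_(i < k) (F i).2)%N => i ik; have [fe fZ fZ'] := FP i ik.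
pose D := (\prod_(j < k | j != Ordinal ik) (F j).2)%N.
have D_gt0 : (0 < D)%N by apply: prodn_cond_gt0 => j _; apply: e_gt0.
exists ((F i).1 ^+ D); last by split; [exact: vanish_onX|move/vanish_on_root].
by rewrite (bigD1 (Ordinal ik)) //=; exact: dhomogMn.
Qed.

(** The Hilbert function of the [i]-th set grows like a polynomial of degree at
    least [i]: the families for [i.+1] and [d.+1] arise from those for [i] and
    [d.+1] and from [f] times those for [i.+1] and [d], which is Pascal's rule. *)
Lemma independent_forms k Z D : form_chain k Z ->
  (forall i, (i < k)%N ->
    exists2 f, f \is D.-homog & vanish_on f (Z i) /\ ~ vanish_on f (Z i.+1)) ->
  forall i d, (i <= k)%N -> exists s,
    [/\ size s = 'C(i + d, i), {in s, forall f, f \is (D * d).-homog} &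
        independent_on (Z i) s].
Proof.
move=> [Zirr Zstep] ZD; elim=> [|i IHi] d.
  move=> /Zirr[[p Zp] _]; have [j vj] : exists j, generator p ord0 j != 0.
    case/matrix0Pn: (generator_neq0 p) => i [j]; rewrite ord1 => vj; by exists j.
  exists [:: 'X_j ^+ (D * d)]; split; first by rewrite bin0.
    move=> f; rewrite inE => /eqP->; rewrite -[X in X.-homog]mul1n.
    by apply: dhomogMn; rewrite dhomogX /= mdeg1.
  move=> c; rewrite big_ord1 /= => /(_ p Zp _ (mem_generator p)).
  rewrite mevalZ rmorphXn /= mevalXU => /eqP.
  rewrite mulf_eq0 expf_eq0 (negPf vj) andbF orbF => /eqP c0 [|//] _; exact: c0.
elim: d => [|d IHd] ik.
  exists [:: 1]; split; first by rewrite addn0 binn.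
    by move=> f; rewrite inE => /eqP->; rewrite muln0; apply: dhomog1.
  have [[p Zp] _] := Zirr _ ik.
  move=> c; rewrite big_ord1 /= => /(_ p Zp _ (mem_generator p)).
  by rewrite mevalZ meval1 mulr1 => c0 [|].
have [s [sz_s s_hom sI]] := IHi d.+1 (ltnW ik).
have [t [sz_t t_hom tI]] := IHd ik.
have [f fD [fZ fZ']] := ZD i ik; have [ZZ' _] := Zstep i ik.
exists (s ++ [seq f * g | g <- t]); split.
- by rewrite size_cat size_map sz_s sz_t addnC [in LHS]addSnnS -binS -addSn.
- move=> g; rewrite mem_cat => /orP[/s_hom//|/mapP[h /t_hom hh ->]].
  by rewrite mulnS; exact: dhomogM.
- exact: independent_on_cat (Zirr _ ik) ZZ' fD fZ fZ' t_hom sI tI.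
Qed.

(** Otherwise the forms independent on the set number [N.+1] of the chain would
    outgrow the space of all forms. *)
Lemma form_chain_leq k Z : form_chain k Z -> (k <= N)%N.
Proof.
move=> ZC; rewrite leqNgt; apply/negP => kN.
have [D DP] := form_chain_common_degree ZC.
have [d] := bin_growth N D.
have [s [<- s_hom sI]] := independent_forms ZC DP d kN.
by rewrite ltnNge (size_independent_on s_hom sI).
Qed.

Lemma irreducible_chain_form_chain Y k Z :
  irreducible_chain Y k Z -> form_chain k Z.
Proof.
move=> [Zcl Zlt]; split=> i ik; first by have [] := Zcl i ik.
have [ZZ' Z'Z] := Zlt i ik; split=> //.
have [_ [A Acl ZE]] := Zcl i (ltnW ik); have [_ [B Bcl ZE']] := Zcl i.+1 ik.
by apply: (separating_form Acl ZE) => //; rewrite ZE' => p [].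
Qed.

(** A point is cut out by the 2 x 2 minors of its coordinates against those of
    the variable point. *)
Lemma zclosed_point (p : proj K N) : zclosed [set p].
Proof.
pose v := generator p.
have Eh i j : homogeneous (v ord0 j *: 'X_i - v ord0 i *: 'X_j).
  by exists 1%N; rewrite rpredB // rpredZ // dhomogX /= mdeg1.
exists [set f | exists i j, f = v ord0 j *: 'X_i - v ord0 i *: 'X_j].
  by move=> _ [i [j ->]].
apply/seteqP; split=> [q -> _ [i [j ->]]|q Sq] /=.
  apply/vanishes_generator => //.
  by rewrite /form_at mevalB !mevalZ !mevalXU mulrC subrr.
have [j vj] : exists j, v ord0 j != 0.
  case/matrix0Pn: (generator_neq0 p) => i [j]; rewrite ord1 => vj; by exists j.
apply: (proj_eq (generator_neq0 q) (mem_generator q)).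
have -> : generator q = (generator q ord0 j / v ord0 j) *: v.
  apply/rowP => i; rewrite mxE.
  have /(_ _ (mem_generator q)) : vanishes (v ord0 j *: 'X_i - v ord0 i *: 'X_j) q.
    by apply: Sq; exists i, j.
  rewrite mevalB !mevalZ !mevalXU => /eqP; rewrite subr_eq0 => /eqP vw.
  by rewrite mulrAC [_ * v ord0 i]mulrC -vw mulrAC divff ?mul1r.
by rewrite memvZ ?mem_generator.
Qed.

(** Only the boundedness of the chains is at stake: a chain of length zero is
    given by any point of [Y]. *)
Lemma has_dim_ex Y b : Y !=set0 ->
  (forall k Z, irreducible_chain Y k Z -> (k <= b)%N) ->
  exists2 k, has_dim Y k & (k <= b)%N.
Proof.
move=> [p Yp] Yb; pose P k := `[< exists Z, irreducible_chain Y k Z >].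
have P0 : exists k, P k.
  exists 0%N; apply/asboolP; exists (fun=> [set p]); split=> // i _; split.
    by split; [exists p|move=> A B _ _ /(_ p erefl)[]; [left|right] => q ->].
  exists [set p]; first exact: zclosed_point.
  by apply/seteqP; split=> q; [move=> ->|case].
have Pb k : P k -> (k <= b)%N by move=> /asboolP[Z /Yb].
case: (ex_maxnP P0 Pb) => k /asboolP[Z ZC] kmax; exists k; last exact: Yb ZC.
split=> [|l Z' Z'C]; first by exists Z.
by apply: kmax; apply/asboolP; exists Z'.
Qed.

End ChainBound.

(** * Irreducibility by rational curves, and dimension of hypersurfaces *)

Section Curves.
Import Order.TTheory GRing.Theory Num.Theory.
Local Open Scope classical_set_scope.
Local Open Scope ring_scope.

Lemma nonroot_ex (K : numFieldType) (P : {poly K}) :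
  P != 0 -> exists t, P.[t] != 0.
Proof.
move=> P0; pose rs : seq K := [seq n%:R | n <- iota 0 (size P)].
have : ~~ all (root P) rs.
  apply/negP => rsP; have := max_poly_roots P0 rsP.
  rewrite map_inj_uniq ?iota_uniq; last by move=> m n /eqP; rewrite eqr_nat => /eqP.
  by rewrite size_map size_iota ltnn => /(_ isT).
by case/allPn => t _ Pt; exists t.
Qed.

Variables (K : numFieldType) (N : nat).
Implicit Types (c : 'rV[{poly K}]_N.+1) (f : {mpoly K[N.+1]}).
Implicit Types (Y : set (proj K N)) (p q : proj K N).

Definition curve_at c (t : K) : 'rV[K]_N.+1 := \row_i (c ord0 i).[t].

Lemma form_along_curve f c :
  exists P : {poly K}, forall t, P.[t] = form_at (curve_at c t) f.
Proof.
exists (\sum_(m <- msupp f) f@_m *: \prod_i c ord0 i ^+ m i) => t.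
rewrite horner_sum /form_at mevalE; apply: eq_bigr => m _.
rewrite hornerZ horner_prod; congr (_ * _); apply: eq_bigr => i _.
by rewrite horner_exp mxE.
Qed.

Definition curve_through c p :=
  exists2 t, curve_at c t != 0 & curve_at c t \in val p.

Lemma nonvanishing_along_curve f c p : homogeneous f -> ~ vanishes f p ->
  curve_through c p ->
  exists2 P : {poly K}, P != 0 & forall t, P.[t] = form_at (curve_at c t) f.
Proof.
move=> fh fp [t ct0 ct]; have [P PE] := form_along_curve f c.
exists P => //; apply/eqP => P0; apply: fp; apply/(vanishesE fh ct ct0).
by rewrite -PE P0 horner0.
Qed.

(** Two forms that do not vanish identically on a rational curve have a common
    nonzero on it, since a nonzero univariate polynomial has a nonroot. *)
Lemma irreducible_of_curves Y : Y !=set0 ->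
  (forall p q, Y p -> Y q -> exists c, [/\ curve_through c p, curve_through c q &
     forall t, curve_at c t != 0 -> exists2 r, Y r & curve_at c t \in val r]) ->
  irreducible Y.
Proof.
move=> Y0 Ycurve; split=> // A B [S Sh ->] [T Th ->] YST.
apply: contrapT => /not_orP[/existsNP[p /not_implyP[Yp /existsNP[f]]]].
move=> /not_implyP[Sf fp] /existsNP[q /not_implyP[Yq /existsNP[g]]].
move=> /not_implyP[Tg gq]; have [c [cp cq cY]] := Ycurve p q Yp Yq.
have [P P0 PE] := nonvanishing_along_curve (Sh f Sf) fp cp.
have [Q Q0 QE] := nonvanishing_along_curve (Th g Tg) gq cq.
have [j cj] : exists j, c ord0 j != 0.
  have [t ct0 _] := cp; case/matrix0Pn: ct0 => i [j]; rewrite mxE => ctj.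
  by exists j; apply: contraNneq ctj => ->; rewrite horner0.
(* The factor [c ord0 j] excludes the parameters where the curve passes through
   the origin and so defines no point. *)
have [t] : exists t, (P * Q * c ord0 j).[t] != 0.
  by apply: nonroot_ex; rewrite !mulf_neq0.
rewrite !hornerM !mulf_eq0 !negb_or PE QE => /andP[/andP[ft gt] cjt].
have ct0 : curve_at c t != 0.
  by apply: contraNneq cjt => /rowP/(_ j); rewrite !mxE => ->.
have [r /YST[fr|gr] rt] := cY t ct0.
  by have /eqP := fr f Sf _ rt; rewrite -/(form_at _ _) (negPf ft).
by have /eqP := gr g Tg _ rt; rewrite -/(form_at _ _) (negPf gt).
Qed.

Lemma irreducible_projT : irreducible [set: proj K N].
Proof.
apply: irreducible_of_curves => [|p q _ _].
  have : (const_mx 1 : 'rV[K]_N.+1) != 0.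
    by apply/eqP => /rowP/(_ ord0)/eqP; rewrite !mxE oner_eq0.
  by move=> v0; exists (proj_point v0).
pose v := generator p; pose w := generator q.
pose c : 'rV[{poly K}]_N.+1 := \row_i ((v ord0 i)%:P + (w ord0 i - v ord0 i) *: 'X).
have cE t : curve_at c t = v + t *: (w - v).
  by apply/rowP => i; rewrite !mxE !hornerE mulrC.
exists c; split.
- exists 0; rewrite cE scale0r addr0; [exact: generator_neq0|exact: mem_generator].
- exists 1; rewrite cE scale1r addrC subrK; first exact: generator_neq0.
  exact: mem_generator.
- by move=> t ct0; exists (proj_point ct0) => //; rewrite memv_line.
Qed.

(** A chain inside a hypersurface can be extended by the whole space. *)
Lemma irreducible_chain_ltn Y f k Z : homogeneous f ->
  ~ vanish_on f setT -> vanish_on f Y -> irreducible_chain Y k Z -> (k < N)%N.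
Proof.
move=> fh fT fY ZC; have [Zirr Zstep] := irreducible_chain_form_chain ZC.
have ZkY : Z k `<=` Y by have [/(_ k (leqnn _))[_ [A _ ->]] _] := ZC; move=> p [].
apply: (@form_chain_leq _ _ k.+1 (fun i => if (i <= k)%N then Z i else setT)).
split=> i ik; first by case: leqP => [/Zirr|_]//; exact: irreducible_projT.
rewrite -ltnS ik; case: (leqP i.+1 k) => [ik'|ki]; first exact: Zstep.
have -> : i = k by apply/eqP; rewrite eqn_leq -ltnS ik.
split=> //; exists f => //; split=> //; exact: vanish_onW ZkY fY.
Qed.

End Curves.

(** * Coordinates on a Segre-Veronese variety *)

Section SegreVeroneseCoordinates.
Import GRing.Theory.
Local Open Scope ring_scope.

Variables (r : nat) (n d : r.-tuple nat).
Implicit Type e : 'I_r -> nat -> nat.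

Definition coord_of (m : mmonom n d) : 'I_(sv_ambient n d).+1 :=
  cast_ord (esym (card_mmonom n d)) (enum_rank m).

Lemma coord_ofK m : mmonom_of (coord_of m) = m.
Proof. by rewrite /mmonom_of /coord_of cast_ordKV enum_rankK. Qed.

Definition exponent (j : 'I_(sv_ambient n d).+1) i (k : 'I_(tnth n i).+1) : nat :=
  bmnm (val (mmonom_of j i)) k.

Lemma sum_exponent j i :
  (\sum_(k : 'I_(tnth n i).+1) exponent j k)%N = tnth d i.
Proof. by rewrite -(eqP (valP (mmonom_of j i))) mdegE. Qed.

Definition word_mnm e i : 'X_{1..(tnth n i).+1} :=
  (\sum_(l < tnth d i) U_(inord (e i l)))%MM.

Lemma mdeg_word e i : mdeg (word_mnm e i) = tnth d i.
Proof.
rewrite mdeg_sum (eq_bigr (fun=> 1%N)) => [|l _]; last by rewrite mdeg1.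
by rewrite sum1_card card_ord.
Qed.

Lemma word_subproof e i : (mdeg (word_mnm e i) < (tnth d i).+1)%N.
Proof. by rewrite mdeg_word. Qed.

(** Spelling monomials letter by letter, instead of giving their exponents, lets
    their values factor when a word is cut into two parts, as for the entries of
    the catalecticant; constant words are products of pure powers. *)
Definition word e : mmonom n d :=
  finfun (fun i => exist _ (BMultinom (word_subproof e i))
                     (introT eqP (mdeg_word e i)) : monom _ _).

Definition word_coord e := coord_of (word e).

Lemma exponent_word e i (k : 'I_(tnth n i).+1) :
  exponent (word_coord e) k = (\sum_(l < tnth d i) (inord (e i l) == k))%N.
Proof.
rewrite /exponent coord_ofK ffunE /= mnm_sumE.
by apply: eq_bigr => l _; rewrite mnm1E.
Qed.

Variable K : fieldType.
Implicit Type x : forall i : 'I_r, 'rV[K]_(tnth n i).+1.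

Lemma sv_mapE x j :
  sv_map d x ord0 j = \prod_i \prod_k x i ord0 k ^+ exponent j k.
Proof. by rewrite mxE. Qed.

Lemma sv_map_word x e : sv_map d x ord0 (word_coord e) =
  \prod_(i < r) \prod_(l < tnth d i) x i ord0 (inord (e i l)).
Proof.
rewrite sv_mapE; apply: eq_bigr => i _.
under eq_bigr => k _ do rewrite exponent_word -prodrXr.
rewrite exchange_big /=; apply: eq_bigr => l _.
rewrite (bigD1 (inord (e i l))) //= eqxx expr1 big1 ?mulr1 // => k.
by rewrite eq_sym => /negPf->; rewrite expr0.
Qed.

(** Choosing a nonzero entry in each factor gives a monomial, a product of pure
    powers, that does not vanish. *)
Lemma sv_map_neq0 x : (forall i, x i != 0) -> sv_map d x != 0.
Proof.
move=> x0; have /choice[g gP] i : exists k : nat, x i ord0 (inord k) != 0.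
  by case/matrix0Pn: (x0 i) => j [k]; rewrite ord1 -[k in x _ _ k]inord_val; exists k.
apply/eqP => /rowP/(_ (word_coord (fun i _ => g i)))/eqP.
rewrite sv_map_word [X in _ == X]mxE; apply/negP.
apply/prodf_neq0 => i _; apply/prodf_neq0 => l _; exact: gP.
Qed.

Lemma factor_neq0 x : (forall i, 0 < tnth d i)%N -> sv_map d x != 0 ->
  forall i, x i != 0.
Proof.
move=> d0 sv0 i; apply: contraNneq sv0 => xi0; apply/eqP/rowP => j.
rewrite sv_mapE [RHS]mxE (bigD1 i) //= xi0 (eq_bigr (fun k => 0 ^+ exponent j k)).
  by rewrite prodrXr sum_exponent expr0n gtn_eqF // mul0r.
by move=> k _; rewrite mxE.
Qed.

Lemma sv_map_vanish x j i k :
  x i ord0 k = 0 -> (0 < exponent j k)%N -> sv_map d x ord0 j = 0.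
Proof.
move=> xk e0; rewrite sv_mapE (bigD1 i) //= (bigD1 k) //=.
by rewrite xk expr0n gtn_eqF // !mul0r.
Qed.

End SegreVeroneseCoordinates.

(** * A lower bound for the dimension of a Segre-Veronese variety *)

Section SegreVeroneseDimension.
Import GRing.Theory.
Local Open Scope classical_set_scope.
Local Open Scope ring_scope.

Variables (r : nat) (n d : r.-tuple nat) (K : numFieldType).
Hypothesis d_gt0 : forall i, (0 < tnth d i)%N.

Notation vectors := (forall i : 'I_r, 'rV[K]_(tnth n i).+1).
Implicit Type x : vectors.

(** The variables other than the first one of each factor; listing them in some
    order, one by one, turns a point into the whole product. *)
Let T : finType := {i : 'I_r & 'I_(tnth n i)}.

Definition flag_vectors s x := forall t : T, (s <= enum_rank t)%N ->
  x (tag t) ord0 (lift ord0 (tagged t)) = 0.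

(** The condition [flag_vectors s], on vectors, transported to the ambient space,
    so that [flag s] is visibly closed in the variety. *)
Definition flag_equations s : set {mpoly K[(sv_ambient n d).+1]} :=
  [set f | exists t : T, exists j, [/\ (s <= enum_rank t)%N,
     (0 < exponent j (lift ord0 (tagged t)))%N & f = 'X_j]].

Definition flag s := segre_veronese K n d `&` zero_locus (flag_equations s).

Lemma homogeneousU N (j : 'I_N.+1) : homogeneous ('X_j : {mpoly K[N.+1]}).
Proof. by exists 1%N; rewrite dhomogX /= mdeg1. Qed.

(** If a variable [x_t] is nonzero, so is some monomial containing it: a power of
    [x_t] times pure powers of nonzero entries of the other factors. *)
Lemma flagP s x (p : proj K (sv_ambient n d)) : (forall i, x i != 0) ->
  val p = <[sv_map d x]>%VS ->
  zero_locus (flag_equations s) p <-> flag_vectors s x.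
Proof.
move=> x0 px; have svp : sv_map d x \in val p by rewrite px memv_line.
have sv0 := sv_map_neq0 d x0; split=> [pA t st|xs _ [t [j [st jt ->]]]]; last first.
  apply/(vanishesE (homogeneousU j) svp sv0).
  by rewrite form_at_coord; apply: sv_map_vanish (xs t st) jt.
apply/eqP; apply: contrapT => /negP xt.
have /choice[g gP] i : exists k : nat,
    x i ord0 (inord k) != 0 /\ (i = tag t -> k = (tagged t).+1).
  have [->|it] := eqVneq i (tag t).
    exists (tagged t).+1; split=> //; rewrite (_ : inord _ = lift ord0 (tagged t)) //.
    by apply/val_inj; rewrite /= inordK // ltnS ltn_ord.
  case/matrix0Pn: (x0 i) => j [k]; rewrite ord1 -[k in x _ _ k]inord_val.
  by exists k; split=> // /eqP; rewrite (negPf it).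
pose j := word_coord n d (fun i _ => g i).
have /(vanishesE (homogeneousU j) svp sv0) : vanishes 'X_j p.
  apply: pA; exists t, j; split=> //; rewrite exponent_word.
  rewrite (eq_bigr (fun=> 1%N)) => [|l _]; first by rewrite sum1_card card_ord.
  have [_ ->//] := gP (tag t).
  apply/eqP; rewrite eqb1; apply/eqP/val_inj; rewrite /= inordK // ltnS ltn_ord //.
rewrite form_at_coord sv_map_word => /eqP; apply/negP.
apply/prodf_neq0 => i _; apply/prodf_neq0 => l _.
by have [] := gP i.
Qed.

Lemma flag_proj_point s x (x0 : forall i, x i != 0) : flag_vectors s x ->
  flag s (proj_point (sv_map_neq0 d x0)).
Proof. by move=> xs; split; [exists x|apply/(flagP _ x0)]. Qed.

(** Two points are joined by the image of the segment between two vectors above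
    them, along which the equations of [flag_vectors], being linear, persist. *)
Lemma irreducible_flag s : irreducible (flag s).
Proof.
apply: irreducible_of_curves => [|p q].
  pose x : vectors := fun i => delta_mx ord0 ord0.
  have x0 i : x i != 0.
    by apply/eqP => /rowP/(_ ord0)/eqP; rewrite !mxE oner_eq0.
  have xs : flag_vectors s x by move=> t _; rewrite mxE.
  by exists (proj_point (sv_map_neq0 d x0)); exact: flag_proj_point.
move=> [[x x0 px] pA] [[y y0 qy] qA].
have xs := (flagP s x0 px).1 pA; have ys := (flagP s y0 qy).1 qA.
pose z t : vectors := fun i => x i + t *: (y i - x i).
pose c : 'rV[{poly K}]_(sv_ambient n d).+1 := \row_j \prod_(i < r) \prod_k
  ((x i ord0 k)%:P + (y i ord0 k - x i ord0 k) *: 'X) ^+ exponent j k.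
have cE t : curve_at c t = sv_map d (z t).
  apply/rowP => j; rewrite !mxE horner_prod; apply: eq_bigr => i _.
  rewrite horner_prod; apply: eq_bigr => k _.
  by rewrite !mxE !hornerE mulrC.
have z0 : z 0 = x.
  by apply/functional_extensionality_dep => i; rewrite /z scale0r addr0.
have z1 : z 1 = y.
  by apply/functional_extensionality_dep => i; rewrite /z scale1r addrC subrK.
exists c; split.
- by exists 0; rewrite cE z0 ?sv_map_neq0 // px memv_line.
- by exists 1; rewrite cE z1 ?sv_map_neq0 // qy memv_line.
- move=> t; rewrite cE => /(factor_neq0 d_gt0) zt0.
  exists (proj_point (sv_map_neq0 d zt0)); last by rewrite memv_line.
  apply: flag_proj_point => u su.
  by rewrite !mxE xs // ys // subrr mulr0 addr0.
Qed.

Lemma flag_lt s : (s < #|T|)%N -> flag s `<` flag s.+1.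
Proof.
move=> sT; split=> [p [Xp pA]|].
  split=> // f [t [j [st jt ->]]]; apply: pA; exists t, j.
  by split=> //; exact: ltnW.
case tE: (enum_val (Ordinal sT) : T) => [i0 k0].
have rank_t : enum_rank (existT _ i0 k0 : T) = s :> nat by rewrite -tE enum_valK.
pose g i : nat := if i == i0 then k0.+1 else 0%N.
pose x : vectors := fun i => \row_k ((k == g i :> nat)%:R).
have lt_g i : (g i < (tnth n i).+1)%N.
  by rewrite /g; case: eqP => [->|//]; rewrite ltnS ltn_ord.
have x0 i : x i != 0.
  apply/eqP => /rowP/(_ (Ordinal (lt_g i)))/eqP.
  by rewrite !mxE eqxx oner_eq0.
have xs : flag_vectors s.+1 x.
  move=> [i k] su; rewrite mxE /g /= /bump /= add1n.
  case: (eqVneq i i0) su => [ii0|//]; subst i; rewrite eqSS.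
  by case: eqP => // /val_inj->; rewrite rank_t ltnn.
move=> /(_ _ (flag_proj_point x0 xs)) [_].
move=> /(flagP (p := proj_point (sv_map_neq0 d x0)) _ x0 erefl).
move=> /(_ (existT _ i0 k0)); rewrite rank_t leqnn => /(_ isT)/eqP.
by rewrite mxE /g eqxx /= /bump /= add1n eqxx oner_eq0.
Qed.

(** The product of the factors has as many variables besides the first ones as
    its dimension, and each of them lengthens the chain of [flag]s by one. *)
Lemma segre_veronese_dim_geq k :
  has_dim (segre_veronese K n d) k -> (\sum_(i < r) tnth n i <= k)%N.
Proof.
move=> [_ /(_ #|T| flag)]; rewrite card_tagged sumnE big_map big_enum /=.
under eq_bigr => i _ do rewrite card_ord.
apply; split=> [s _|s sT]; last first.
  apply: flag_lt; rewrite card_tagged sumnE big_map big_enum /=.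
  by under eq_bigr => i _ do rewrite card_ord.
split; first exact: irreducible_flag.
exists (zero_locus (flag_equations s)) => //; exists (flag_equations s) => //.
by move=> _ [t [j [_ _ ->]]]; exact: homogeneousU.
Qed.

Lemma segre_veronese_neq0 : segre_veronese K n d !=set0.
Proof. by have [[p [Xp _]] _] := irreducible_flag 0; exists p. Qed.

End SegreVeroneseDimension.

(** * Defectivity from a form vanishing on the secant spaces *)

Section DefectivityCriterion.
Import GRing.Theory.
Local Open Scope classical_set_scope.
Local Open Scope ring_scope.

Variables (K : numFieldType) (N : nat).

(** The form confines the secant variety to a hypersurface, while the inequality
    makes [N] its expected dimension; a lower bound [m] for the dimension of [X]
    is enough for the latter, which increases with that dimension. *)
Lemma defective_of_form (h m : nat) (X : set (proj K N)) (f : {mpoly K[N.+1]}) :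
  (0 < h)%N -> X !=set0 -> (forall k, has_dim X k -> (m <= k)%N) ->
  (N <= m * h + h - 1)%N -> homogeneous f -> ~ vanish_on f setT ->
  (forall (q : 'I_h -> proj K N) v, (forall i, X (q i)) ->
     v \in (\sum_(i < h) val (q i))%VS -> form_at v f = 0) ->
  defective h X.
Proof.
move=> h0 X0 Xm Nm fh fT f_span; pose Sec := secant_variety h X.
have Sec0 : Sec !=set0.
  have [p Xp] := X0; exists p => Z _; apply; exists (fun=> p) => //.
  by rewrite (bigD1 (Ordinal h0)) //= addvSl.
have fSec : vanish_on f Sec.
  move=> p Sp; have : zero_locus [set f] p; last exact.
  apply: Sp; first exact: zclosed1.
  move=> p' [q Xq /subvP p'q] _ ->; apply/(vanishes_generator _ fh).
  by apply: (f_span q) => //; apply/p'q/mem_generator.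
have [n Xn _] := has_dim_ex X0
  (fun k Z ZC => form_chain_leq (irreducible_chain_form_chain ZC)).
have [|s Secs sN] := @has_dim_ex _ _ Sec N.-1 Sec0.
  move=> k Z /(irreducible_chain_ltn fh fT fSec) kN.
  by rewrite -ltnS (leq_trans kN) // leqSpred.
have N0 : (0 < N)%N.
  have [[Z ZC] _] := Secs.
  by apply: leq_ltn_trans (irreducible_chain_ltn fh fT fSec ZC).
exists n, s; split=> //; rewrite /expected_secant_dim leq_min andbC.
have sN' : (s < N)%N by rewrite -(prednK N0) ltnS.
rewrite sN' (leq_trans sN') // (leq_trans Nm) // leq_sub2r // leq_add2r.
by rewrite leq_mul2r Xm ?orbT.
Qed.

Lemma dhomog_det (R : comNzRingType) (n m : nat) (A : 'M[{mpoly R[n]}]_m) :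
  (forall i j, A i j \is 1.-homog) -> \det A \is m.-homog.
Proof.
move=> A1; apply: rpred_sum => s _.
have prodA k : forall F : 'I_k -> {mpoly R[n]},
    (forall i, F i \is 1.-homog) -> \prod_i F i \is k.-homog.
  elim: k => [|k IHk] F F1; first by rewrite big_ord0; exact: dhomog1.
  by rewrite big_ord_recl; apply: (@dhomogM _ _ _ 1 _ k) => //; exact: IHk.
case: (perm.odd_perm s); rewrite ?expr0 ?expr1 ?mul1r ?mulN1r ?dhomogN;
  by apply: prodA.
Qed.

End DefectivityCriterion.

(** * The catalecticant form *)

Section Catalecticant.
Import GRing.Theory.
Local Open Scope classical_set_scope.
Local Open Scope ring_scope.

Variables (p q n : nat).
Hypotheses (p_gt0 : (0 < p)%N) (q_gt0 : (0 < q)%N) (n_gt1 : (1 < n)%N).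
Hypothesis pq : (2 * p = n.+1 * q)%N.
Variable K : numFieldType.

Let h := (2 * p).-1.
Let hE : (2 * p = h.+1)%N. Proof. by rewrite prednK // muln_gt0. Qed.

Notation dims := [tuple 1; 1; n]%N.
Notation degs := [tuple 1; p.-1 + q.-1; 1]%N.
Let N := sv_ambient dims degs.

Let f0 : 'I_3 := ord0.
Let f1 : 'I_3 := lift ord0 ord0.
Let f2 : 'I_3 := lift ord0 (lift ord0 ord0).

Let NE : N.+1 = (2 * (p.-1 + q.-1).+1 * n.+1)%N.
Proof.
rewrite /N /sv_ambient prednK ?prodn_gt0 // => [|i]; last by rewrite bin_gt0 leq_addl.
rewrite !big_ord_recl big_ord0 muln1 mulnA.
by rewrite -[tnth _ _]/1%N; congr (_ * _ * _)%N; rewrite /= ?addn1 ?add1n ?bin1 ?binSn.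
Qed.

(** Row [s] stands for the pair of [s %/ p], a variable of the first factor, and
    [s %% p], an exponent of the second variable in degree [p.-1] on the second
    factor; column [t] for an exponent [q.-1 - t %% q] in degree [q.-1] on the
    second factor and a variable [t %/ q] of the third. The entry is the product
    of these monomials. Its word on the second factor lists the [p.-1] letters
    determined by [s] before the [q.-1] letters determined by [t], so that its
    value on the variety splits as a function of [s] times one of [t]. The column
    exponents run backwards so that the nonzero entries of [cat_witness] fall on
    the diagonal. *)
Definition cat_word (s t : nat) (i : 'I_3) (l : nat) : nat :=
  match val i with
  | 0 => s %/ p
  | 1 => if (l < p.-1)%N then (l < s %% p)%N : nat
         else (l - p.-1 < q.-1 - t %% q)%N
  | _ => t %/ q
  end.

Definition cat_index (s t : 'I_h.+1) : 'I_N.+1 :=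
  word_coord dims degs (cat_word s t).

Definition catalecticant (v : 'rV[K]_N.+1) : 'M[K]_h.+1 :=
  \matrix_(s, t) v ord0 (cat_index s t).

Definition cat_form : {mpoly K[N.+1]} := \det (\matrix_(s, t) 'X_(cat_index s t)).

Lemma form_at_cat_form v : form_at v cat_form = \det (catalecticant v).
Proof.
rewrite /form_at /cat_form -det_map_mx; congr (\det _).
by apply/matrixP => s t; rewrite !mxE /= mevalXU.
Qed.

Lemma dhomog_cat_form : cat_form \is h.+1.-homog.
Proof.
by apply: dhomog_det => s t; rewrite mxE dhomogX /= mdeg1.
Qed.

Lemma sum_ltn_ord (m i : nat) : (i <= m)%N -> (\sum_(l < m) (l < i)%N)%N = i.
Proof.
move=> im; rewrite -[RHS]card_ord -sum1_card (big_ord_widen_cond m predT (fun=> 1%N)) //.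
by rewrite [RHS]big_mkcond; apply: eq_bigr => l _; case: ltnP.
Qed.

(** The entries are values of products of a monomial attached to the row and a
    monomial attached to the column. *)
Lemma rank_catalecticant_sv (x : forall i, 'rV[K]_(tnth dims i).+1) :
  (\rank (catalecticant (sv_map degs x)) <= 1)%N.
Proof.
pose u : 'cV[K]_h.+1 := \col_s (x f0 ord0 (inord (s %/ p)) *
  \prod_(l < p.-1) x f1 ord0 (inord (l < s %% p)%N)).
pose w : 'rV[K]_h.+1 := \row_t (
  (\prod_(l < q.-1) x f1 ord0 (inord (l < q.-1 - t %% q)%N)) *
  x f2 ord0 (inord (t %/ q))).
suff -> : catalecticant (sv_map degs x) = u *m w.
  by rewrite (leq_trans (mxrankM_maxl _ _)) // rank_leq_col.
apply/matrixP => s t; rewrite mxE sv_map_word [RHS]mxE big_ord1 !mxE.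
have prod3 (F : 'I_3 -> K) : \prod_i F i = F f0 * F f1 * F f2.
  by rewrite !big_ord_recl big_ord0 mulr1 mulrA.
rewrite prod3 -!mulrA; congr (_ * _); first exact: big_ord1.
rewrite mulrA; congr (_ * _); last exact: big_ord1.
rewrite -[LHS]/(\prod_(l < (p.-1 + q.-1)%N) _) big_split_ord /=.
congr (_ * _); apply: eq_bigr => l _; rewrite /cat_word /=.
  by rewrite ltn_ord.
by rewrite ltnNge leq_addr addKn.
Qed.

(** The catalecticant is linear, so on a span of [h] points its rank is at most
    [h], while its size is [h.+1]. *)
Lemma span_cat_form (P : 'I_h -> proj K N) v :
  (forall i, segre_veronese K dims degs (P i)) ->
  v \in (\sum_(i < h) val (P i))%VS -> form_at v cat_form = 0.
Proof.
move=> XP /memv_sumP[w wP ->]; rewrite form_at_cat_form.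
have -> : catalecticant (\sum_i w i) = \sum_i catalecticant (w i).
  by apply/matrixP => s t; rewrite mxE !summxE; apply: eq_bigr => i _; rewrite mxE.
have rk : (\rank (\sum_i catalecticant (w i))%R <= \sum_(i < h) 1)%N.
  elim/big_rec2: _ => [|i m A _ rA]; first by rewrite mxrank0.
  rewrite (leq_trans (mxrank_add _ _)) // leq_add //.
  have [x x0 Px] := XP i; have := wP i isT; rewrite Px => /vlineP[c ->].
  have -> : catalecticant (c *: sv_map degs x) = c *: catalecticant (sv_map degs x).
    by apply/matrixP => s t; rewrite !mxE.
  by rewrite (leq_trans (mxrank_scale _ _)) // rank_catalecticant_sv.
apply/eqP; apply: contraLR rk; rewrite -unitfE -unitmxE => /mxrank_unit->.
by rewrite sum1_card card_ord ltnn.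
Qed.

Lemma inord_eq1 (k m : nat) :
  (m <= 1)%N -> ((inord m : 'I_k.+2) == inord 1) = m :> nat.
Proof. by case: m => [|[|//]] _; rewrite -val_eqE /= !inordK. Qed.

(** The coordinates set to 1 are those on which two weights agree: at row [s] and
    column [t] the left-hand weight, which reads the first two factors, is
    [s + (q.-1 - t %% q)], and the right-hand one, which reads the third factor,
    is [t - t %% q + q.-1]. They are equal exactly when [s = t]. *)
Definition cat_witness : 'rV[K]_N.+1 := \row_j
  (p * exponent j (inord 1 : 'I_(tnth dims f0).+1)
     + exponent j (inord 1 : 'I_(tnth dims f1).+1)
   == \sum_(k : 'I_(tnth dims f2).+1) k * q * exponent j k + q.-1)%N%:R.

Lemma catalecticant_witness : catalecticant cat_witness = 1%:M.
Proof.
apply/matrixP => s t; rewrite !mxE !exponent_word; congr (_%:R).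
have [s_lt t_lt] : (s < 2 * p)%N /\ (t < n.+1 * q)%N by rewrite -pq hE !ltn_ord.
have sp : (s %/ p <= 1)%N by rewrite -ltnS ltn_divLR.
have tq : (t %/ q <= n)%N by rewrite -ltnS ltn_divLR.
rewrite [X in (p * X + _)%N](_ : _ = s %/ p)%N; last first.
  by rewrite [LHS]big_ord1; exact: inord_eq1.
rewrite [X in (_ + X == _)%N](_ : _ = s %% p + (q.-1 - t %% q))%N; last first.
  rewrite -[LHS]/(\sum_(l < (p.-1 + q.-1)%N) _)%N big_split_ord /=.
  have sp' : (s %% p <= p.-1)%N by rewrite -ltnS prednK ?ltn_pmod.
  rewrite -[RHS](congr2 addn (sum_ltn_ord sp') (sum_ltn_ord (leq_subr (t %% q) q.-1))).
  congr (_ + _)%N; apply: eq_bigr => l _; rewrite /cat_word /=.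
    by rewrite ltn_ord; apply: inord_eq1; rewrite leq_b1.
  by rewrite ltnNge leq_addr addKn; apply: inord_eq1; rewrite leq_b1.
rewrite [X in (_ == X + _)%N](_ : _ = t %/ q * q)%N; last first.
  have ex2 (k : 'I_(tnth dims f2).+1) :
      exponent (cat_index s t) k = (k == t %/ q :> nat)%N.
    by rewrite exponent_word [LHS]big_ord1 eq_sym -val_eqE /= inordK.
  under eq_bigr => k _ do rewrite ex2.
  rewrite -[LHS]/(\sum_(k < n.+1) k * q * (k == t %/ q :> nat))%N.
  rewrite (bigD1 (Ordinal (tq : t %/ q < n.+1)%N)) //= eqxx muln1 big1 ?addn0 //.
  by move=> k; rewrite -val_eqE /= => /negPf->; rewrite muln0.
rewrite -val_eqE /=; have := divn_eq s p; have := divn_eq t q.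
have := ltn_pmod s p_gt0; have := ltn_pmod t q_gt0.
move: (s %/ p)%N (s %% p)%N (t %/ q)%N (t %% q)%N => e i k j jq ip -> ->.
by rewrite (mulnC p); apply/eqP/eqP; lia.
Qed.

Lemma cat_form_neq0 : ~ vanish_on cat_form setT.
Proof.
have detW : form_at cat_witness cat_form = 1.
  by rewrite form_at_cat_form catalecticant_witness det1.
have W0 : cat_witness != 0.
  apply: contraTneq (oner_neq0 K) => W0.
  by rewrite -{1}detW W0 (form_at_dhomog0 _ dhomog_cat_form) ?eqxx.
move=> /(_ (proj_point W0) I _ (memv_line _)) /eqP.
by rewrite -/(form_at _ _) detW oner_eq0.
Qed.

(** Since [1 < n], the relation [pq] forces [1 < p], hence a positive degree on
    the second factor, and makes [h] points expected to fill the space. *)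
Lemma segre_veronese_catalecticant_defective :
  defective h (segre_veronese K dims degs).
Proof.
have degs_gt0 : forall i, (0 < tnth degs i)%N.
  case=> [[|[|[|//]]]] i3; rewrite (tnth_nth 0%N) //=.
  by rewrite addn_gt0; case: (p) pq p_gt0 => [|[|]] //; nia.
apply: (defective_of_form (m := n.+2) (f := cat_form)).
- by rewrite -ltnS -hE; case: (p) p_gt0 => // m _; rewrite mulnS.
- exact: segre_veronese_neq0.
- move=> k /(segre_veronese_dim_geq degs_gt0).
  by rewrite !big_ord_recl big_ord0 addn0; apply: id.
- by rewrite -ltnS NE; move: pq hE; nia.
- by exists h.+1; exact: dhomog_cat_form.
- exact: cat_form_neq0.
- exact: span_cat_form.
Qed.

End Catalecticant.

(** * The defective varieties *)

Theorem corollary6p5 (R : realType) :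
  (forall n : nat, 2 <= n ->
     (forall a : nat, 1 <= a ->
        defective (2 * a * (n + 1) - 1)
          (segre_veronese R[i] [tuple 1; 1; n]
             [tuple 1; a * (n + 3) - 2; 1])) /\
     (odd n -> forall a : nat, 1 <= a ->
        defective (a * (n + 1) - 1)
          (segre_veronese R[i] [tuple 1; 1; n]
             [tuple 1; (a * (n + 3)) %/ 2 - 2; 1]))) /\
  defective 11
    (segre_veronese R[i] [tuple 1; 1; 3] [tuple 1; 7; 1]).
Proof.
have cat n p q : 2 <= n -> 0 < p -> 0 < q -> 2 * p = n.+1 * q ->
    defective (2 * p).-1
      (segre_veronese R[i] [tuple 1; 1; n] [tuple 1; p.-1 + q.-1; 1]).
  by move=> n2 p0 q0 pq; exact: segre_veronese_catalecticant_defective.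
have odd_case n a : 2 <= n -> odd n -> 1 <= a ->
    defective (a * (n + 1) - 1)
      (segre_veronese R[i] [tuple 1; 1; n] [tuple 1; (a * (n + 3)) %/ 2 - 2; 1]).
  move=> n2 n_odd a1; pose m := n./2.
  have nE : n = m.*2.+1 by rewrite -[LHS]odd_double_half n_odd.
  have := cat n (a * m.+1) a n2.
  have -> : (2 * (a * m.+1)).-1 = a * (n + 1) - 1 by nia.
  have -> : (a * m.+1).-1 + a.-1 = (a * (n + 3)) %/ 2 - 2.
    have -> : a * (n + 3) = a * m.+2 * 2 by nia.
    by rewrite mulnK //; nia.
  by apply; nia.
split=> [n n2|]; last exact: (odd_case 3 3).
split=> [a a1|]; last by move=> n_odd a; exact: odd_case.
have := cat n (a * n.+1) (2 * a) n2.
have -> : (2 * (a * n.+1)).-1 = 2 * a * (n + 1) - 1 by nia.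
have -> : (a * n.+1).-1 + (2 * a).-1 = a * (n + 3) - 2 by nia.
by apply; nia.
Qed.
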